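(* Let $I$ be an open interval ($\dim I=1$), let $F$ be a Riemannian manifold with $\dim F=n-1$, $n\ge 3$, and let $M=I_f\times{}_hF$ be a doubly warped product manifold with metric $g$ which is Einstein with respect to the semi-symmetric metric connection $\tilde\nabla$ associated with a vector field $P$. If $P\in\mathfrak{X}(I)$, then $f$ is constant on $F$ or $Ph=h\,\pi(P)$.
   Context: For Riemannian manifolds $(B,g_B)$, $(F,g_F)$ and smooth functions $h:B\to(0,\infty)$, $f:F\to(0,\infty)$, with projections $\rho:B\times F\to B$, $\sigma:B\times F\to F$, the doubly warped product $B_f\times{}_hF$ is $B\times F$ with the metric $g=(f\circ\sigma)^2\rho^*g_B+(h\circ\rho)^2\sigma^*g_F$; here $B=I$. The functions $f,h$ and vector fields on $I$ and $F$ are identified with their lifts to $M$; $P\in\mathfrak{X}(I)$ means the lift of a vector field of $I$. $\nabla$ is the Levi-Civita connection of $g$ and $\pi(A)=g(A,P)$. The semi-symmetric metric connection on $M$ associated with $P$ is $\tilde\nabla_AC=\nabla_AC+\pi(C)A-g(A,C)P$. Conventions: $\tilde R(A,C)D=\tilde\nabla_A\tilde\nabla_CD-\tilde\nabla_C\tilde\nabla_AD-\tilde\nabla_{[A,C]}D$ and $\tilde S(C,D)=\mathrm{trace}(A\mapsto\tilde R(A,C)D)$. $M$ is Einstein with respect to $\tilde\nabla$ if $\tilde S=\alpha g$ for a constant $\alpha$.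
   Formalization: The Riemannian manifold F is additionally assumed connected; for disconnected F the claim fails, since f may take different constant values on different components while Ph differs from hπ(P). *)

(* Defs.v *)
From HB Require Import structures.
From mathcomp Require Import all_boot all_order all_algebra.
From mathcomp Require Import all_classical all_reals all_analysis.
From mathcomp Require Import ring.

Set Implicit Arguments.
Unset Strict Implicit.
Unset Printing Implicit Defensive.

Import Order.TTheory GRing.Theory Num.Theory.
Import numFieldNormedType.Exports.

Local Open Scope classical_set_scope.
Local Open Scope ring_scope.

(* The model spaces used below are finite dimensional, where this is the usual
   class of C^k functions. *)
Fixpoint Ck_on (R : realType) (E G : normedModType R) (k : nat) (U : set E)
    (f : E -> G) : Prop :=
  match k with
  | 0%N => forall x, U x -> {for x, continuous f}
  | k'.+1 => (forall x, U x -> differentiable f x) /\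
             forall v : E, Ck_on k' U (fun x => 'D_v f x)
  end.

Definition smooth_on (R : realType) (E G : normedModType R) (U : set E)
    (f : E -> G) : Prop :=
  forall k, Ck_on k U f.

Section SmoothOnTheory.
Variable R : realType.
Implicit Types E G H : normedModType R.

Lemma Ck_onW E G k (U : set E) (f : E -> G) : Ck_on k.+1 U f -> Ck_on k U f.
Proof.
elim: k f => [|k IH] f; first by case=> df _ x /df/differentiable_continuous.
by move=> [df Df]; split=> // v; apply: IH.
Qed.

Lemma Ck_on_sub E G k (U V : set E) (f : E -> G) :
  U `<=` V -> Ck_on k V f -> Ck_on k U f.
Proof.
move=> UV; elim: k f => [|k IH] f /=; first by move=> + x /UV; exact.
by move=> [df Df]; split=> [x /UV/df//|v]; apply: IH.
Qed.

Lemma near_eq_differentiable E G (f g : E -> G) (x : E) :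
  {near x, f =1 g} -> differentiable f x -> differentiable g x.
Proof.
move=> fg df; have [cf ef] := (diff_locallyP _ _).1 df.
have eg : g \o shift x = cst (g x) + 'd f x +o_ 0 id.
  apply/eqaddoP => e e0; move/eqaddoP/(_ _ e0) : ef; apply: filter_app.
  move: (fg); rewrite (near_shift 0 x) /= subr0.
  apply: filter_app; near=> y => fgy.
  by rewrite /= !fctE /= fgy (nbhs_singleton fg).
by apply/diff_locallyP; rewrite (diff_unique cf eg).
Unshelve. all: by end_near. Qed.

Lemma Ck_on_eq E G k (U : set E) (f g : E -> G) :
  open U -> (forall x, U x -> f x = g x) -> Ck_on k U f -> Ck_on k U g.
Proof.
move=> oU; elim: k f g => [|k IH] f g fg.
  all: have nfg x : U x -> {near x, f =1 g}
    by move=> Ux; apply: filterS fg _; exact: open_nbhs_nbhs.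
  move=> cf x Ux; rewrite /prop_for /continuous_at -(fg _ Ux).
  by apply: cvg_trans (cf _ Ux); apply: near_eq_cvg; exact: nfg.
move=> [df Df]; split=> [x Ux|v].
  exact: near_eq_differentiable (nfg _ Ux) (df _ Ux).
by apply: IH (Df v) => x Ux; apply: near_eq_derive; exact: nfg.
Qed.

Lemma smooth_on_cst E G (U : set E) (a : G) : smooth_on U (fun=> a).
Proof.
move=> k; elim: k a => [|k IH] a; first by move=> x _; exact: cvg_cst.
split=> [x _|v]; first exact: differentiable_cst.
by under eq_fun do rewrite derive_cst.
Qed.

Lemma Ck_onD E G k (U : set E) (f g : E -> G) : open U ->
  Ck_on k U f -> Ck_on k U g -> Ck_on k U (fun x => f x + g x).
Proof.
move=> oU; elim: k f g => [|k IH] f g.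
  by move=> cf cg x Ux; apply: continuousD; [exact: cf|exact: cg].
move=> [df Df] [dg Dg]; split=> [x Ux|v].
  by apply: differentiableD; [exact: df|exact: dg].
apply: (@Ck_on_eq _ _ _ _ (fun x => 'D_v f x + 'D_v g x)) => //;
  last exact: IH (Df v) (Dg v).
by move=> x Ux; rewrite -[RHS]/(derive (f + g) x v) deriveD//;
  apply: diff_derivable; first [exact: df|exact: dg].
Qed.

Lemma smooth_onD E G (U : set E) (f g : E -> G) : open U ->
  smooth_on U f -> smooth_on U g -> smooth_on U (fun x => f x + g x).
Proof. by move=> oU sf sg k; exact: Ck_onD. Qed.

Lemma smooth_onM E (U : set E) (f g : E -> R^o) : open U ->
  smooth_on U f -> smooth_on U g -> smooth_on U (fun x => f x * g x : R^o).
Proof.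
move=> oU + + k => /(_ k) + /(_ k).
elim: k f g => [|k IH] f g.
  by move=> cf cg x Ux; apply: continuousM; [exact: cf|exact: cg].
move=> fk gk; have [df Df] := fk; have [dg Dg] := gk; split=> [x Ux|v].
  by apply: differentiableM; [exact: df|exact: dg].
apply: (@Ck_on_eq _ _ _ _ (fun x => f x * 'D_v g x + g x * 'D_v f x : R^o)) => //.
  move=> x Ux; rewrite -[RHS]/(derive (f * g) x v) deriveM//;
    apply: diff_derivable; first [exact: df|exact: dg].
by apply: Ck_onD => //;
  [exact: IH (Ck_onW fk) (Dg v)|exact: IH (Ck_onW gk) (Df v)].
Qed.

Lemma smooth_on_fst E G H (U : set E) (f : E -> H) :
  smooth_on U f -> smooth_on (fst @^-1` U) (fun x : E * G => f x.1).
Proof.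
move=> + k => /(_ k); elim: k f => [|k IH] f.
  move=> cf x Ux; apply: (@continuous_comp _ _ _ fst f); first exact: cvg_fst.
  exact: cf.
move=> [df Df]; split=> [x Ux|v]; last exact: (IH _ (Df v.1)).
apply: (@differentiable_comp _ _ _ _ fst f); last exact: df.
by apply: linear_differentiable => y; exact: cvg_fst.
Qed.

Lemma smooth_on_snd E G H (U : set G) (f : G -> H) :
  smooth_on U f -> smooth_on (snd @^-1` U) (fun x : E * G => f x.2).
Proof.
move=> + k => /(_ k); elim: k f => [|k IH] f.
  move=> cf x Ux; apply: (@continuous_comp _ _ _ snd f); first exact: cvg_snd.
  exact: cf.
move=> [df Df]; split=> [x Ux|v]; last exact: (IH _ (Df v.2)).
apply: (@differentiable_comp _ _ _ _ snd f); last exact: df.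
by apply: linear_differentiable => y; exact: cvg_snd.
Qed.

Lemma smooth_on_pair E G H (U : set E) (f : E -> G) (g : E -> H) : open U ->
  smooth_on U f -> smooth_on U g -> smooth_on U (fun x => (f x, g x)).
Proof.
move=> oU + + k => /(_ k) + /(_ k).
elim: k f g => [|k IH] f g.
  by move=> cf cg x Ux; apply: cvg_pair; [exact: cf|exact: cg].
move=> [df Df] [dg Dg]; split=> [x Ux|v].
  by apply: differentiable_pair; [exact: df|exact: dg].
apply: (@Ck_on_eq _ _ _ _ (fun x => ('D_v f x, 'D_v g x))) => //;
  last exact: IH (Df v) (Dg v).
move=> x Ux; rewrite !deriveE ?diff_pair//; try exact: df; try exact: dg.
by apply: differentiable_pair; [exact: df|exact: dg].
Qed.

End SmoothOnTheory.

Record chart (R : realType) (E : normedModType R) (T : topologicalType) :=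
  Chart { chart_dom : set T; chart_map :> T -> E }.

Arguments Chart {R E T}.

Section Charts.
Variables (R : realType) (E : normedModType R) (T : topologicalType).
Implicit Types (c d : chart E T) (U : set T).

(* A homeomorphism of an open set onto an open set; the values of the map
   outside of its domain are irrelevant. *)
Definition is_chart c : Prop :=
  [/\ open (chart_dom c), set_inj (chart_dom c) c,
      forall p, chart_dom c p -> {for p, continuous c} &
      forall V, open V -> V `<=` chart_dom c -> open (c @` V)].

(* phi is f \o c^-1 *)
Definition smooth_in (G : normedModType R) c U (f : T -> G) : Prop :=
  exists2 phi : E -> G, smooth_on (c @` (chart_dom c `&` U)) phi &
    forall p, chart_dom c p -> U p -> f p = phi (c p).

End Charts.

(* The atlas need not be maximal: the smooth structure is the one that it
   generates.  Connectedness is not required. *)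
Record manifold (R : realType) (E : normedModType R) := Manifold {
  manifold_top :> topologicalType;
  atlas : set (chart E manifold_top);
  manifold_hausdorff : hausdorff_space manifold_top;
  manifold_second_countable : @second_countable manifold_top;
  atlas_chart : forall c, atlas c -> is_chart c;
  atlas_cover : forall p, exists2 c, atlas c & chart_dom c p;
  atlas_compat : forall c d, atlas c -> atlas d -> smooth_in c (chart_dom d) d
}.

Section RealOpen.
Variables (R : realType) (I : set R) (oI : open I).

Let val_chart : chart R^o (set_type I : topologicalType) := Chart setT set_val.

Lemma real_open_hausdorff : hausdorff_space (set_type I).
Proof.
move=> p q pq; apply: val_inj; apply: (@Rhausdorff R) => A B Ap Bq.
have cv := @initial_continuous (set_type I) R set_val.
have [r [Ar Br]] := pq _ _ (cv p A Ap) (cv q B Bq).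
by exists (set_val r).
Qed.

Lemma real_second_countable : @second_countable R.
Proof.
exists [set `]ratr ab.1, ratr ab.2[%classic | ab in [set: rat * rat]].
  apply: sub_countable (card_image_le _ _) _; exact: countableP.
split=> [_ [ab _ <-]|x A /nbhs_ballP[e /= e0 xA]]; first exact: interval_open.
have [a] : exists a : rat, ratr a \in `]x - e, x[.
  by apply: rat_in_itvoo; rewrite ltrBlDr ltrDl.
have [b] : exists a : rat, ratr a \in `]x, x + e[.
  by apply: rat_in_itvoo; rewrite ltrDl.
rewrite !in_itv/= => /andP[xb be] /andP[ea ax].
exists `]ratr a, ratr b[%classic; last first.
  move=> y /=; rewrite in_itv/= => /andP[ay yb]; apply: xA.
  rewrite /ball/= ltr_distlC; apply/andP; split.
    exact: lt_trans ay.
  exact: lt_trans yb _.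
by split; [exists (a, b)|rewrite /= in_itv/= ax xb].
Qed.

Lemma real_open_second_countable : @second_countable (set_type I).
Proof.
have [B cB [oB nB]] := real_second_countable.
exists [set set_val @^-1` U | U in B]; first exact: sub_countable (card_image_le _ _) cB.
split=> [_ [U BU <-]|x A /= ].
  by exists U => //; exact: oB.
rewrite nbhsE => -[_ [[W oW <-] Wx] WA].
have [U [BU Ux] UW] := nB (set_val x) W (open_nbhs_nbhs (conj oW Wx)).
exists (set_val @^-1` U); first by split=> //; exists U.
by move=> y Uy; apply: WA; exact: UW.
Qed.

Lemma val_chart_chart : is_chart val_chart.
Proof.
split; first exact: openT.
- by move=> p q _ _ /val_inj.
- by move=> p _; exact: initial_continuous.
- move=> _ [W oW <-] _; rewrite (_ : _ @` _ = W `&` I); first exact: openI.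
  apply/seteqP; split=> [_ [p Wp <-]|x [Wx Ix]].
    by split=> //; exact: set_valP.
  by exists (SigSub (mem_set Ix)).
Qed.

Lemma smooth_in_val_chart U : smooth_in val_chart U val_chart.
Proof.
exists id => // -[|k]; first by move=> x _; exact: cvg_id.
split=> [x _|v]; first exact: ex_diff.
by under eq_fun do rewrite derive_id; exact: smooth_on_cst.
Qed.

Definition real_open_manifold : manifold R^o.
Proof.
refine (@Manifold R R^o (set_type I) [set val_chart] real_open_hausdorff
  real_open_second_countable _ _ _).
- by move=> c ->; exact: val_chart_chart.
- by move=> p; exists val_chart.
- by move=> c d -> ->; exact: smooth_in_val_chart.
Defined.

End RealOpen.

Section Product.
Variables (R : realType) (E1 E2 : normedModType R).
Variables (M : manifold E1) (N : manifold E2).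

Definition prod_chart (c : chart E1 M) (d : chart E2 N) :
    chart (E1 * E2)%type (M * N)%type :=
  Chart (chart_dom c `*` chart_dom d) (fun p => (c p.1, d p.2)).

Lemma prod_hausdorff : hausdorff_space (M * N)%type.
Proof.
move=> p q pq; rewrite [p]surjective_pairing [q]surjective_pairing.
congr pair.
  apply: (@manifold_hausdorff _ _ M) => A B Ap Bq.
  have [r [Ar Br]] := pq _ _ (cvg_fst Ap) (cvg_fst Bq).
  by exists r.1.
apply: (@manifold_hausdorff _ _ N) => A B Ap Bq.
have [r [Ar Br]] := pq _ _ (cvg_snd Ap) (cvg_snd Bq).
by exists r.2.
Qed.

Lemma prod_open (A : set M) (B : set N) : open A -> open B -> open (A `*` B).
Proof.
move=> oA oB; rewrite openE => -[x y] [/= Ax By].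
by exists (A, B) => //; split; exact: open_nbhs_nbhs.
Qed.

Lemma prod_second_countable : @second_countable (M * N)%type.
Proof.
have [B cB [oB nB]] := @manifold_second_countable _ _ M.
have [C cC [oC nC]] := @manifold_second_countable _ _ N.
exists [set UV.1 `*` UV.2 | UV in B `*` C].
  exact: sub_countable (card_image_le _ _) (countableX cB cC).
split=> [_ [[U V] [/= /oB oU /oC oV] <-]|[x y] A [[U V] [/= Ux Vy] UVA]].
  exact: prod_open.
have [U' [BU' U'x] UU'] := nB _ _ Ux; have [V' [CV' V'y] VV'] := nC _ _ Vy.
exists (U' `*` V'); first by split=> //; exists (U', V').
by move=> -[a b] [/= /UU' Ua /VV' Vb]; apply: UVA.
Qed.

Lemma prod_chart_chart c d :
  is_chart c -> is_chart d -> is_chart (prod_chart c d).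
Proof.
move=> [oc ic cc Oc] [od id cd Od]; split.
- exact: prod_open.
- move=> [a b] [a' b'] /set_mem[/= ca db] /set_mem[/= ca' db'] [e1 e2].
  by congr pair; [apply: ic|apply: id] => //; exact: mem_set.
- move=> [a b] [/= ca db]; apply: cvg_pair => /=.
    move=> A /(cc _ ca) cA; exists (c @^-1` A, setT); last by move=> ? [].
    by split=> //; exact: filterT.
  move=> A /(cd _ db) dA; exists (setT, d @^-1` A); last by move=> ? [].
  by split=> //; exact: filterT.
- move=> V oV Vdom; rewrite openE => _ [[a b] Vab <-].
  have [[A B] [/= Aa Bb] ABV] := open_nbhs_nbhs (conj oV Vab).
  have [/= ca db] := Vdom _ Vab.
  exists (c @` (A^° `&` chart_dom c), d @` (B^° `&` chart_dom d)).
    split; apply: open_nbhs_nbhs.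
      split; last by exists a.
      by apply: Oc => [|? []//]; apply: openI => //; exact: open_interior.
    split; last by exists b.
    by apply: Od => [|? []//]; apply: openI => //; exact: open_interior.
  move=> [_ _] [/= [a' [Aa' ca'] <-] [b' [Bb' db'] <-]].
  exists (a', b') => //; apply: ABV; split=> /=; exact: interior_subset.
Qed.

Lemma smooth_in_prod_chart c d c' d' :
  is_chart c -> is_chart d -> is_chart c' -> is_chart d' ->
  smooth_in c (chart_dom c') c' -> smooth_in d (chart_dom d') d' ->
  smooth_in (prod_chart c d) (chart_dom (prod_chart c' d')) (prod_chart c' d').
Proof.
move=> cc cd cc' cd' [f sf ef] [g sg eg].
exists (fun x => (f x.1, g x.2)).
  apply: smooth_on_pair.
  - have [_ _ _ Op] := prod_chart_chart cc cd; apply: Op; last by move=> ? [].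
    have [op _ _ _] := prod_chart_chart cc cd.
    by have [op' _ _ _] := prod_chart_chart cc' cd'; exact: openI.
  - move=> k; apply: (@Ck_on_sub _ (E1 * E2)%type _ _ _ _ _ _ (smooth_on_fst E2 sf k)).
    by move=> _ [[a b] [[/= ca db] [/= ca' db']] <-]; exists a.
  - move=> k; apply: (@Ck_on_sub _ (E1 * E2)%type _ _ _ _ _ _ (smooth_on_snd E1 sg k)).
    by move=> _ [[a b] [[/= ca db] [/= ca' db']] <-]; exists b.
by move=> [a b] [/= ca db] [/= ca' db']; rewrite (ef a)// (eg b).
Qed.

Definition prod_manifold : manifold (E1 * E2)%type.
Proof.
refine (@Manifold R _ (M * N)%type
  [set prod_chart cd.1 cd.2 | cd in @atlas _ _ M `*` @atlas _ _ N]
  prod_hausdorff prod_second_countable _ _ _).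
- move=> _ [[c d] [/= ac ad] <-].
  by apply: prod_chart_chart; exact: atlas_chart.
- move=> p; have [c ac cp] := atlas_cover p.1; have [d ad dp] := atlas_cover p.2.
  by exists (prod_chart c d) => //; exists (c, d).
- move=> _ _ [[c d] [/= ac ad] <-] [[c' d'] [/= ac' ad'] <-].
  apply: smooth_in_prod_chart; try exact: atlas_chart; exact: atlas_compat.
Defined.

End Product.

Section SmoothFunctions.
Variables (R : realType) (E : normedModType R) (M : manifold E).

Definition smooth (f : M -> R^o) : Prop :=
  forall c, @atlas _ _ M c -> smooth_in c setT f.

Definition smooth_pred : {pred M -> R^o} := mem [set f | smooth f].

Lemma smooth_predP f : reflect (smooth f) (f \in smooth_pred).
Proof. by apply: (iffP idP) => [/set_mem|/mem_set]. Qed.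

Let open_image (c : chart E M) : @atlas _ _ M c ->
  open (c @` (chart_dom c `&` setT)).
Proof.
by move=> /atlas_chart[oc _ _ Oc]; rewrite setIT; exact: Oc.
Qed.

Lemma smooth_cst (a : R) : smooth (fun=> a).
Proof. by move=> c _; exists (fun=> a) => //; exact: smooth_on_cst. Qed.

Lemma smoothD (f g : M -> R^o) : smooth f -> smooth g -> smooth (f + g).
Proof.
move=> sf sg c ac; have [u su fu] := sf c ac; have [v sv gv] := sg c ac.
exists (fun x => u x + v x); first by apply: smooth_onD => //; exact: open_image.
by move=> p cp _; rewrite -fu// -gv.
Qed.

Lemma smoothM (f g : M -> R^o) : smooth f -> smooth g -> smooth (f * g).
Proof.
move=> sf sg c ac; have [u su fu] := sf c ac; have [v sv gv] := sg c ac.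
exists (fun x => u x * v x); first by apply: smooth_onM => //; exact: open_image.
by move=> p cp _; rewrite -fu// -gv.
Qed.

Lemma smoothZ (a : R) (f : M -> R^o) : smooth f -> smooth (a *: f).
Proof. exact: (smoothM (smooth_cst a)). Qed.

Lemma smooth_subring_closed : subring_closed smooth_pred.
Proof.
split=> [|f g /smooth_predP sf /smooth_predP sg|f g /smooth_predP sf /smooth_predP sg];
  apply/smooth_predP; [exact: smooth_cst| |exact: smoothM].
by apply: smoothD => //; rewrite -scaleN1r; exact: smoothZ.
Qed.

HB.instance Definition _ :=
  GRing.isSubringClosed.Build (M -> R^o) smooth_pred smooth_subring_closed.

Lemma smooth_scaler_closed : GRing.scaler_closed smooth_pred.
Proof. by move=> a f /smooth_predP sf; apply/smooth_predP; exact: smoothZ. Qed.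

HB.instance Definition _ :=
  GRing.isScaleClosed.Build R (M -> R^o) smooth_pred smooth_scaler_closed.

Record Cinf := MkCinf { Cinf_fun :> M -> R^o; _ : Cinf_fun \in smooth_pred }.

HB.instance Definition _ := [isSub for Cinf_fun].
HB.instance Definition _ := [Choice of Cinf by <:].
HB.instance Definition _ := GRing.SubChoice_isSubComPzRing.Build
  (M -> R^o) smooth_pred Cinf smooth_subring_closed.
HB.instance Definition _ := [SubZmodule_isSubLmodule of Cinf by <:].

Lemma Cinf_smooth (f : Cinf) : smooth f.
Proof. by apply/smooth_predP; exact: valP. Qed.

Lemma Cinf_eq (f g : Cinf) : (forall p, f p = g p) -> f = g.
Proof. by move=> fg; apply: val_inj; apply/funext. Qed.

Lemma CinfD (f g : Cinf) p : (f + g) p = f p + g p. Proof. by []. Qed.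
Lemma CinfN (f : Cinf) p : (- f) p = - f p. Proof. by []. Qed.
Lemma CinfM (f g : Cinf) p : (f * g) p = f p * g p. Proof. by []. Qed.
Lemma CinfZ (a : R) (f : Cinf) p : (a *: f) p = a * f p. Proof. by []. Qed.

End SmoothFunctions.


Definition mkCinf (R : realType) (E : normedModType R) (M : manifold E)
    (f : M -> R^o) (sf : smooth f) : Cinf M :=
  MkCinf (introT (smooth_predP f) sf).

Section TangentVectors.
Variables (R : realType) (E : normedModType R) (M : manifold E).

(* Tangent vectors at p are the point derivations of C^oo(M) at p. *)
Definition point_derivation (p : M) (v : Cinf M -> R^o) : Prop :=
  (forall (a : R) f g, v (a *: f + g) = a * v f + v g) /\
  (forall f g, v (f * g) = v f * g p + f p * v g).

Definition tangent_pred (p : M) : {pred Cinf M -> R^o} :=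
  mem [set v | point_derivation p v].

Lemma tangent_predP p v : reflect (point_derivation p v) (v \in tangent_pred p).
Proof. by apply: (iffP idP) => [/set_mem|/mem_set]. Qed.

Lemma tangent_submod_closed p : submod_closed (tangent_pred p).
Proof.
split=> [|a v w /tangent_predP[vl vd] /tangent_predP[wl wd]].
  apply/tangent_predP; split=> [b f g|f g]; rewrite -[LHS]/0.
    by rewrite -[RHS]/(b * 0 + 0) mulr0 addr0.
  by rewrite -[RHS]/(0 * g p + f p * 0) mul0r mulr0 addr0.
have lcE f : (a *: v + w) f = a * v f + w f by [].
by apply/tangent_predP; split=> [b f g|f g]; rewrite !lcE ?vl ?wl ?vd ?wd; ring.
Qed.

HB.instance Definition _ p := GRing.isSubmodClosed.Build R (Cinf M -> R^o)
  (tangent_pred p) (tangent_submod_closed p).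

Record tangent (p : M) := MkTangent {
  tangent_fun :> Cinf M -> R^o; _ : tangent_fun \in tangent_pred p }.

HB.instance Definition _ p := [isSub for @tangent_fun p].
HB.instance Definition _ p := [Choice of tangent p by <:].
HB.instance Definition _ p := [SubChoice_isSubLmodule of tangent p by <:].

Lemma tangentP p (v : tangent p) : point_derivation p v.
Proof. by apply/tangent_predP; exact: valP. Qed.

(* Vector fields are the derivations of C^oo(M), a module over C^oo(M). *)
Definition derivation (X : Cinf M -> (Cinf M)^o) : Prop :=
  (forall (a : R) f g, X (a *: f + g) = a *: (X f : Cinf M) + X g) /\
  (forall f g, X (f * g) = X f * g + f * X g).

Definition vfield_pred : {pred Cinf M -> (Cinf M)^o} :=
  mem [set X | derivation X].

Lemma vfield_predP X : reflect (derivation X) (X \in vfield_pred).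
Proof. by apply: (iffP idP) => [/set_mem|/mem_set]. Qed.

Lemma vfield_submod_closed : submod_closed vfield_pred.
Proof.
split=> [|h X Y /vfield_predP[Xl Xd] /vfield_predP[Yl Yd]].
  apply/vfield_predP; split=> [a f g|f g]; apply: Cinf_eq => p; rewrite -[LHS]/0.
    by rewrite -[RHS]/(a * 0 + 0) mulr0 addr0.
  by rewrite -[RHS]/(0 * g p + f p * 0) mul0r mulr0 addr0.
have lcE f p : (h *: X + Y) f p = h p * X f p + Y f p by [].
apply/vfield_predP; split=> [a f g|f g]; apply: Cinf_eq => p.
  rewrite lcE Xl Yl -[RHS]/(a * ((h *: X + Y) f : Cinf M) p + (h *: X + Y) g p).
  by rewrite !lcE !(CinfD, CinfZ); ring.
rewrite lcE Xd Yd -[RHS]/((h *: X + Y) f p * g p + f p * (h *: X + Y) g p).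
by rewrite !lcE !(CinfD, CinfM); ring.
Qed.

HB.instance Definition _ := GRing.isSubmodClosed.Build (Cinf M)
  (Cinf M -> (Cinf M)^o) vfield_pred vfield_submod_closed.

Record vfield := MkVfield {
  vfield_fun :> Cinf M -> (Cinf M)^o; _ : vfield_fun \in vfield_pred }.

HB.instance Definition _ := [isSub for vfield_fun].
HB.instance Definition _ := [Choice of vfield by <:].
HB.instance Definition _ := [SubChoice_isSubLmodule of vfield by <:].

Lemma vfieldP (X : vfield) : derivation X.
Proof. by apply/vfield_predP; exact: valP. Qed.

Lemma vfield_at_subproof (X : vfield) (p : M) :
  (fun f => (X f : Cinf M) p) \in tangent_pred p.
Proof.
have [Xl Xd] := vfieldP X; apply/tangent_predP; split=> [a f g|f g].
  by rewrite Xl CinfD CinfZ.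
by rewrite Xd CinfD !CinfM.
Qed.

Definition vfield_at (X : vfield) (p : M) : tangent p :=
  MkTangent (vfield_at_subproof X p).

Lemma bracket_subproof (X Y : vfield) :
  (fun f => X (Y f) - Y (X f)) \in vfield_pred.
Proof.
have [Xl Xd] := vfieldP X; have [Yl Yd] := vfieldP Y.
have XD f g : X (f + g) = X f + X g by rewrite -[f]scale1r Xl !scale1r.
have YD f g : Y (f + g) = Y f + Y g by rewrite -[f]scale1r Yl !scale1r.
apply/vfield_predP; split=> [a f g|f g]; apply: Cinf_eq => p.
  by rewrite Yl Xl Xl Yl !(CinfD, CinfN, CinfZ); ring.
by rewrite Yd Xd XD YD !Xd !Yd !(CinfD, CinfN, CinfM); ring.
Qed.

Definition bracket (X Y : vfield) : vfield := MkVfield (bracket_subproof X Y).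

End TangentVectors.

Section SmoothMaps.
Variables (R : realType) (E1 E2 : normedModType R).
Variables (M : manifold E1) (N : manifold E2).

Record smooth_map := SmoothMap {
  smooth_map_fun :> M -> N;
  smooth_mapP : forall f : Cinf N, smooth (f \o smooth_map_fun)
}.

Definition pullback (F : smooth_map) (f : Cinf N) : Cinf M :=
  mkCinf (smooth_mapP F f).

Lemma differential_subproof (F : smooth_map) (p : M) (v : tangent p) :
  (fun f => v (pullback F f)) \in tangent_pred (F p).
Proof.
have [vl vd] := tangentP v; apply/tangent_predP; split=> [a f g|f g].
  by rewrite -vl; congr (v _); exact: Cinf_eq.
by rewrite -[f (F p)]/(pullback F f p) -[g (F p)]/(pullback F g p) -vd;
  congr (v _); exact: Cinf_eq.
Qed.

Definition differential (F : smooth_map) (p : M) (v : tangent p) :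
    tangent (F p) :=
  MkTangent (differential_subproof F v).

End SmoothMaps.

Section Projections.
Variables (R : realType) (E1 E2 : normedModType R).
Variables (M : manifold E1) (N : manifold E2).

Lemma proj1_smooth (f : Cinf M) :
  @smooth _ _ (prod_manifold M N) (f \o fst).
Proof.
move=> _ [[c d] [/= ac ad] <-]; have [phi sphi fphi] := Cinf_smooth f ac.
exists (fun x => phi x.1); last by move=> [a b] [/= ca _] _; rewrite fphi.
move=> k; apply: (@Ck_on_sub _ (E1 * E2)%type _ _ _ _ _ _ (smooth_on_fst E2 sphi k)).
by move=> _ [[a b] [[/= ca _] _] <-]; exists a.
Qed.

Lemma proj2_smooth (f : Cinf N) :
  @smooth _ _ (prod_manifold M N) (f \o snd).
Proof.
move=> _ [[c d] [/= ac ad] <-]; have [phi sphi fphi] := Cinf_smooth f ad.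
exists (fun x => phi x.2); last by move=> [a b] [/= _ db] _; rewrite fphi.
move=> k; apply: (@Ck_on_sub _ (E1 * E2)%type _ _ _ _ _ _ (smooth_on_snd E1 sphi k)).
by move=> _ [[a b] [[/= _ db] _] <-]; exists b.
Qed.

Definition proj1 : smooth_map (prod_manifold M N) M :=
  @SmoothMap _ _ _ (prod_manifold M N) M fst proj1_smooth.

Definition proj2 : smooth_map (prod_manifold M N) N :=
  @SmoothMap _ _ _ (prod_manifold M N) N snd proj2_smooth.

End Projections.

Section Riemannian.
Variables (R : realType) (E : normedModType R) (M : manifold E).

Record riemannian_metric := RiemannianMetric {
  metric_at :> forall p : M, tangent p -> tangent p -> R;
  metric_sym : forall p (v w : tangent p), metric_at v w = metric_at w v;
  metric_linear : forall p (a : R) (u v w : tangent p),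
    metric_at (a *: u + v) w = a * metric_at u w + metric_at v w;
  metric_pos : forall p (v : tangent p), v != 0 -> 0 < metric_at v v;
  metric_smooth : forall X Y : vfield M,
    smooth (fun p => metric_at (vfield_at X p) (vfield_at Y p))
}.

Definition metric (g : riemannian_metric) (X Y : vfield M) : Cinf M :=
  mkCinf (metric_smooth g X Y).

Implicit Types (g : riemannian_metric) (D : vfield M -> vfield M -> vfield M).

(* D A C is the covariant derivative of C along A. *)
Definition is_connection D : Prop :=
  [/\ forall (a : Cinf M) (A B C : vfield M), D (a *: A + B) C = a *: D A C + D B C,
      forall A B C : vfield M, D A (B + C) = D A B + D A C &
      forall (A : vfield M) (a : Cinf M) (C : vfield M),
        D A (a *: C) = (A a : Cinf M) *: C + a *: D A C].

Definition torsion_free D : Prop :=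
  forall A C : vfield M, D A C - D C A = bracket A C.

Definition metric_compatible g D : Prop :=
  forall A B C : vfield M,
    A (metric g B C) = metric g (D A B) C + metric g B (D A C).

Definition levi_civita g D : Prop :=
  [/\ is_connection D, torsion_free D & metric_compatible g D].

Definition semi_symmetric_metric_connection g D (P : vfield M)
    (A C : vfield M) : vfield M :=
  D A C + metric g C P *: A - metric g A C *: P.

Definition curvature D (A C X : vfield M) : vfield M :=
  D A (D C X) - D C (D A X) - D (bracket A C) X.

(* In the following definitions n is the dimension of M. *)

Definition basis_at (n : nat) (p : M) (X : 'I_n -> vfield M) : Prop :=
  forall v : tangent p,
    exists! a : 'rV[R]_n, v = \sum_(i < n) a 0 i *: vfield_at (X i) p.

(* For a C^oo(M)-linear L, the value (L A)_p depends only on A_p.  This says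
   that s is the trace of the induced endomorphism of T_p M, computed in a basis
   made of values of vector fields; every basis of T_p M is of this form. *)
Definition is_trace_at (n : nat) (p : M) (L : vfield M -> vfield M) (s : R) :
    Prop :=
  exists (X : 'I_n -> vfield M) (c : 'M[R]_n),
    [/\ basis_at p X,
        forall i,
          vfield_at (L (X i)) p = \sum_(j < n) c i j *: vfield_at (X j) p &
        s = \tr c].

Definition is_ricci (n : nat) D (S : vfield M -> vfield M -> Cinf M) : Prop :=
  forall C X p, is_trace_at n p (fun A => curvature D A C X) (S C X p).

Definition einstein (n : nat) g D : Prop :=
  exists (S : vfield M -> vfield M -> Cinf M) (alpha : R),
    is_ricci n D S /\ forall C X, S C X = alpha *: metric g C X.

End Riemannian.

Section DoublyWarped.
Variables (R : realType) (E1 E2 : normedModType R).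
Variables (B : manifold E1) (F : manifold E2).

(* g = (f \o proj2)^2 proj1^* gB + (h \o proj1)^2 proj2^* gF.  This determines
   g; its smoothness is part of the type of g. *)
Definition is_doubly_warped (gB : riemannian_metric B) (gF : riemannian_metric F)
    (f : Cinf F) (h : Cinf B) (g : riemannian_metric (prod_manifold B F)) : Prop :=
  [/\ (forall x, 0 < f x), (forall t, 0 < h t) &
      forall (p : prod_manifold B F) (v w : tangent p),
        g p v w =
          pullback (proj2 B F) f p ^+ 2 *
            gB _ (differential (proj1 B F) v) (differential (proj1 B F) w) +
          pullback (proj1 B F) h p ^+ 2 *
            gF _ (differential (proj2 B F) v) (differential (proj2 B F) w)].

(* The unique vector field on B x F that is proj1-related to Q and proj2-related
   to 0 *)
Definition is_lift1 (Q : vfield B) (P : vfield (prod_manifold B F)) : Prop :=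
  (forall u : Cinf B,
     P (pullback (proj1 B F) u) = pullback (proj1 B F) (Q u)) /\
  (forall u : Cinf F, P (pullback (proj2 B F) u) = 0).

End DoublyWarped.

(* Main.v *)
Require Import Defs.
From HB Require Import structures.
From mathcomp Require Import all_boot all_order all_algebra.
From mathcomp Require Import all_classical all_reals all_analysis.
From mathcomp Require Import ring lra.

(** Write [pi A = g(A, P)].  The connection [D] associated with [P] is metric and
    has torsion [pi(C) A - pi(A) C].  Its first Bianchi identity reads

      [R(A,C)X + R(C,X)A + R(X,A)C
         = - (dpi(C,X) A + dpi(X,A) C + dpi(A,C) X)],

    and tracing it over [A] gives [S(C,X) - S(X,C) = (2 - n) dpi(C,X)], because
    [R(C,X)] is skew for [g] and so has no trace ([ricci_antisym]).  The Einstein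
    condition makes the Ricci tensor [S] symmetric; as [n >= 3], the form [pi] is
    closed ([einstein_dual_form_d]).

    Now let [P] be the lift of [Q].  Then [pi = f^2 rho^* gB(Q, -)], and for a field
    [V] tangent to the fibres [{t} x F],

      [dpi(V,P) = 2 f V(f) gB(Q,Q)].

    If [Q] is nonzero at some [t], then closedness with [V] the gradient of [f]
    shows that [f] has no differential on the connected slice [{t} x F], so [f] is
    constant ([closed_lift_critical], [critical_constant]).  Otherwise [P = 0], and
    both sides of [P h = h pi(P)] vanish.

    Vector fields are here global derivations, so two steps that are usually local
    are done algebraically.  Around a point, a family [X] of [n] fields that is a
    basis there has a Gram matrix, whose determinant [delta] is a global function,
    nonzero exactly where [X] is a basis.  Cramer's rule produces, from prescribed
    functions [b_k], a global field [W] with [g(W, X_k) = delta^2 b_k]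
    ([cramer_field]).  With [b_k = g(A, X_k)] this writes [delta^2 A] as a
    combination of the [X_k] whose coefficients vanish where [A] does, hence every
    [C^oo]-linear operation on fields is pointwise ([linear_at_tensorial]); with
    [b_k = X_k f] it gives [delta^2] times the gradient of [f]. *)

Set Implicit Arguments.
Unset Strict Implicit.
Unset Printing Implicit Defensive.

Import Order.TTheory GRing.Theory Num.Theory.
Import numFieldNormedType.Exports.

Local Open Scope classical_set_scope.
Local Open Scope ring_scope.

(** * Bases, traces and inner products *)

Section LinearCombinations.
Variables (R : realFieldType) (T : lmodType R).

Definition lincomb (U : lmodType R) n (a : 'rV[R]_n) (X : 'I_n -> U) : U :=
  \sum_(i < n) a 0 i *: X i.

Definition is_basis n (X : 'I_n -> T) : Prop :=
  forall v, exists! a : 'rV[R]_n, v = lincomb a X.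

Definition represents n (X : 'I_n -> T) (c : 'M[R]_n) (l : T -> T) : Prop :=
  forall i, l (X i) = \sum_(j < n) c i j *: X j.

Lemma lincombP (U : lmodType R) n (k : R) (a b : 'rV[R]_n) (X : 'I_n -> U) :
  lincomb (k *: a + b) X = k *: lincomb a X + lincomb b X.
Proof.
rewrite /lincomb scaler_sumr -big_split; apply: eq_bigr => i _ /=.
by rewrite !mxE scalerDl scalerA.
Qed.

Lemma lincomb_mulmx (U : lmodType R) m n (a : 'rV[R]_m) (c : 'M[R]_(m, n))
    (X : 'I_m -> U) (Y : 'I_n -> U) :
  (forall i, X i = lincomb (row i c) Y) -> lincomb a X = lincomb (a *m c) Y.
Proof.
move=> XY; rewrite /lincomb.
under eq_bigr do rewrite XY /lincomb scaler_sumr.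
rewrite exchange_big; apply: eq_bigr => j _ /=.
rewrite mxE scaler_suml; apply: eq_bigr => i _.
by rewrite scalerA mxE.
Qed.

Lemma linear_lincomb (U : lmodType R) (l : T -> U) n (a : 'rV[R]_n)
    (X : 'I_n -> T) :
  linear l -> l (lincomb a X) = lincomb a (l \o X).
Proof.
move=> ll; have lD v w : l (v + w) = l v + l w.
  by rewrite -[v]scale1r ll !scale1r.
have l0 : l 0 = 0 by apply: (addrI (l 0)); rewrite -lD !addr0.
rewrite /lincomb (big_morph l lD l0); apply: eq_bigr => i _.
by rewrite -[X in l X]addr0 ll l0 addr0.
Qed.

Lemma basis_coord n (X : 'I_n -> T) : is_basis X -> exists co : T -> 'rV[R]_n,
  [/\ forall v, v = lincomb (co v) X, forall a, co (lincomb a X) = a & linear co].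
Proof.
move=> bX.
have /choice[co coE] : forall v, exists a, v = lincomb a X.
  by move=> v; have [a []] := bX v; exists a.
have inj a b : lincomb a X = lincomb b X -> a = b.
  move=> ab; have [c [_ uc]] := bX (lincomb a X).
  by rewrite -(uc a)// -(uc b).
exists co; split=> // [a|k v w]; apply: inj; first by rewrite -coE.
by rewrite lincombP -!coE.
Qed.

Lemma basis_inj n (X : 'I_n -> T) a b :
  is_basis X -> lincomb a X = lincomb b X -> a = b.
Proof. by move=> /basis_coord[co [_ coK _]] ab; rewrite -(coK a) ab coK. Qed.

Lemma representsP n (X : 'I_n -> T) c l a : linear l -> represents X c l ->
  l (lincomb a X) = lincomb (a *m c) X.
Proof.
move=> ll rl; rewrite linear_lincomb//; apply: lincomb_mulmx => i /=.
by rewrite rl; apply: eq_bigr => j _; rewrite mxE.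
Qed.

Lemma represents_exists n (X : 'I_n -> T) l :
  is_basis X -> exists c, represents X c l.
Proof.
move=> /basis_coord[co [coE _ _]].
exists (\matrix_(i, j) co (l (X i)) 0 j) => i.
by rewrite [LHS]coE; apply: eq_bigr => j _; rewrite mxE.
Qed.

Lemma change_of_basis n (X Y : 'I_n -> T) : is_basis X ->
  exists a : 'M[R]_n, forall i, Y i = lincomb (row i a) X.
Proof.
move=> /basis_coord[co [coE _ _]]; exists (\matrix_i co (Y i)) => i.
by rewrite rowK -coE.
Qed.

Lemma lincomb_delta n (X : 'I_n -> T) i : lincomb (delta_mx 0 i) X = X i.
Proof.
rewrite /lincomb (bigD1 i)//= mxE !eqxx scale1r big1 ?addr0// => j ji.
by rewrite mxE eqxx (negbTE ji) scale0r.
Qed.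

(** The Ricci tensor at [(C, X)] and at [(X, C)] may come with different bases.  The
    matrix [a] of the change of basis conjugates [d] into [c]. *)
Lemma represents_trace n (X Y : 'I_n -> T) c d l : linear l ->
  is_basis X -> is_basis Y -> represents X c l -> represents Y d l ->
  \tr c = \tr d.
Proof.
move=> ll bX bY rc rd.
have [a YX] := change_of_basis Y bX; have [b XY] := change_of_basis X bY.
have ba : b *m a = 1%:M.
  apply/row_matrixP => i; rewrite row_mul row1; apply: (basis_inj bX).
  by rewrite -(lincomb_mulmx _ YX) -XY lincomb_delta.
have ac : a *m c = d *m a.
  apply/row_matrixP => i; rewrite !row_mul; apply: (basis_inj bX).
  rewrite -(lincomb_mulmx _ YX) -(representsP _ ll rc) -YX rd.
  by apply: eq_bigr => j _; rewrite mxE.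
by rewrite -[c]mul1mx -ba -mulmxA ac mulmxA mxtrace_mulC mulmxA (mulmx1C ba) mul1mx.
Qed.

End LinearCombinations.

Section InnerProduct.
Variables (R : realFieldType) (T : lmodType R) (b : T -> T -> R).
Hypothesis b_sym : forall v w, b v w = b w v.
Hypothesis b_lin : forall a u v w, b (a *: u + v) w = a * b u w + b v w.
Hypothesis b_pos : forall v, v != 0 -> 0 < b v v.

Definition gram n (X : 'I_n -> T) : 'M[R]_n := \matrix_(i, j) b (X i) (X j).

Let bl w : linear (fun v => b v w : R^o). Proof. by move=> a u v; exact: b_lin. Qed.

Lemma inner_lincomb n (a : 'rV[R]_n) X w :
  b (lincomb a X) w = \sum_i a 0 i * b (X i) w.
Proof. exact: (linear_lincomb a X (bl w)). Qed.

Lemma inner0 w : b 0 w = 0.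
Proof. by have := b_lin (-1) 0 0 w; rewrite scaler0 addr0 mulN1r addNr. Qed.

Lemma inner_sum n (a : 'I_n -> R) (X : 'I_n -> T) w :
  b (\sum_i a i *: X i) w = \sum_i a i * b (X i) w.
Proof.
transitivity (b (lincomb (\row_i a i) X) w).
  by congr b; apply: eq_bigr => i _; rewrite mxE.
by rewrite inner_lincomb; apply: eq_bigr => i _; rewrite mxE.
Qed.

Lemma gramE m n (a : 'rV[R]_m) (c : 'rV[R]_n) (X : 'I_m -> T) (Y : 'I_n -> T) :
  b (lincomb a X) (lincomb c Y) =
  (a *m (\matrix_(i, j) b (X i) (Y j)) *m c^T) 0 0.
Proof.
rewrite inner_lincomb -mulmxA mxE; apply: eq_bigr => i _; congr (_ * _).
rewrite b_sym inner_lincomb mxE; apply: eq_bigr => j _.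
by rewrite !mxE mulrC b_sym.
Qed.

Lemma inner_nondegenerate v : (forall w, b v w = 0) -> v = 0.
Proof. by move=> v0; apply/eqP; apply: contraT => /b_pos; rewrite v0 ltxx. Qed.

Lemma gram_basis_unit n (X : 'I_n -> T) : is_basis X -> gram X \in unitmx.
Proof.
move=> bX; rewrite -row_free_unit; apply/row_freeP.
suff : kermx (gram X) = 0.
  by move/eqP; rewrite kermx_eq0 => /row_freeP.
apply/row_matrixP => i; rewrite row0; set a := row i _.
have aG : a *m gram X = 0 by rewrite -row_mul mulmx_ker row0.
apply: (basis_inj bX); have -> : lincomb 0 X = 0.
  by apply: big1 => j _; rewrite mxE scale0r.
apply/eqP; apply: contraT => /b_pos.
by rewrite gramE -/(gram X) aG mul0mx mxE ltxx.
Qed.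

(** Independent vectors span as soon as there are as many of them as in some basis;
    the coordinates of [X] in [Y] form an invertible matrix. *)
Lemma gram_unit_span n (X Y : 'I_n -> T) : is_basis Y -> gram X \in unitmx ->
  forall v, exists a, v = lincomb a X.
Proof.
move=> bY uX v; have [a XY] := change_of_basis X bY.
have GX : gram X = a *m gram Y *m a^T.
  apply/matrixP => i j; rewrite mxE XY (XY j) gramE -/(gram Y).
  rewrite tr_row -row_mul [LHS]mxE [RHS]mxE.
  by apply: eq_bigr => k _; rewrite !mxE.
have ua : a \in unitmx by move: uX; rewrite GX !unitmx_mul => /andP[/andP[]].
have [co [coE _ _]] := basis_coord bY.
exists (co v *m invmx a).
by rewrite (lincomb_mulmx _ XY) mulmxKV// -coE.
Qed.

(** Skewness reads [c G = - G c^T] with [G] the Gram matrix, so [c] is conjugate to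
    [- c^T]. *)
Lemma skew_trace n (X : 'I_n -> T) c l : is_basis X -> linear l ->
  represents X c l -> (forall v, b (l v) v = 0) -> \tr c = 0.
Proof.
move=> bX ll rc skew.
have skew2 v w : b (l v) w = - b v (l w).
  have bD u u' w' : b (u + u') w' = b u w' + b u' w'.
    by rewrite -[u]scale1r b_lin mul1r scale1r.
  have lD : l (v + w) = l v + l w by rewrite -[v]scale1r ll !scale1r.
  have := skew (v + w).
  rewrite lD bD ![b _ (v + w)]b_sym !bD !(b_sym _ (l _)) !skew add0r addr0.
  by move=> /eqP; rewrite addr_eq0 => /eqP.
have cG : c *m gram X = - (gram X *m c^T).
  apply/matrixP => i j.
  have rl k : l (X k) = lincomb (row k c) X.
    by rewrite rc; apply: eq_bigr => m _; rewrite mxE.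
  have := skew2 (X i) (X j); rewrite (b_sym (X i)) !rl !inner_lincomb => E.
  rewrite [LHS]mxE [RHS]mxE [X in _ = - X]mxE.
  transitivity (\sum_k (row i c) 0 k * b (X k) (X j)).
    by apply: eq_bigr => k _; rewrite !mxE.
  rewrite E; congr (- _); apply: eq_bigr => k _.
  by rewrite !mxE mulrC (b_sym (X i)).
have uG := gram_basis_unit bX.
have : \tr c = - \tr c.
  rewrite -{1}[c](mulmxK uG) cG mulNmx !raddfN /=.
  by rewrite mxtrace_mulC mulmxA mulVmx// mul1mx mxtrace_tr.
by move/eqP; rewrite -subr_eq0 opprK -mulr2n mulrn_eq0 => /eqP.
Qed.

End InnerProduct.

(** The trace of the Bianchi identity at one point: [l], [m] and [s] stand for the
    three curvature terms, and the two maps of rank one on the right contribute the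
    values of [phi] and [psi] to the trace. *)
Lemma trace_bianchi (R : realFieldType) (T : lmodType R) (b : T -> T -> R)
    (b_sym : forall v w, b v w = b w v)
    (b_lin : forall a u v w, b (a *: u + v) w = a * b u w + b v w)
    (b_pos : forall v, v != 0 -> 0 < b v v)
    n (X Y : 'I_n -> T) (c d : 'M[R]_n) (l m s : T -> T) (u w : T) (k : R)
    (phi psi : T -> R^o) :
  is_basis X -> is_basis Y -> linear l -> linear m -> linear s ->
  linear phi -> linear psi ->
  represents X c l -> represents Y d m -> (forall v, b (s v) v = 0) ->
  (forall v, l v + s v - m v = - (k *: v + phi v *: u + psi v *: w)) ->
  \tr c - \tr d = - (k *+ n + phi u + psi w).
Proof.
move=> bX bY ll lm ls lphi lpsi rc rd skew E.
have [e re] := represents_exists s bX; have [d' rd'] := represents_exists m bX.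
have te := skew_trace b_sym b_lin b_pos bX ls re skew.
rewrite -(represents_trace lm bX bY rd' rd).
have [co [coE coK lco]] := basis_coord bX.
have coB v v' : co (v - v') = co v - co v'.
  by rewrite addrC -scaleN1r lco scaleN1r addrC.
have coD v v' : co (v + v') = co v + co v'.
  by rewrite -[v]scale1r lco !scale1r.
have coZ a v : co (a *: v) = a *: co v.
  by rewrite -[a *: v]addr0 lco -(subrr v) coB subrr addr0.
have ofrow A f : represents X A f -> forall i, row i A = co (f (X i)).
  move=> rA i; rewrite rA -[LHS]coK; congr co.
  by apply: eq_bigr => j _; rewrite mxE.
(* [om] times a fixed vector [z] has trace [om z]. *)
have rank1 (om : T -> R^o) z : linear om ->
    \tr (\matrix_i (om (X i) *: co z)) = om z.
  move=> lom; rewrite {2}[z]coE (linear_lincomb _ _ lom) /mxtrace.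
  by apply: eq_bigr => i _; rewrite !mxE mulrC.
have -> : \tr c - \tr d' = \tr (c + e - d').
  by rewrite mxtraceD raddfN /= mxtraceD te addr0.
have -> : c + e - d' = - (k%:M + \matrix_i (phi (X i) *: co u) +
     \matrix_i (psi (X i) *: co w)).
  apply/row_matrixP => i.
  rewrite raddfB raddfD raddfN !raddfD /= !rowK (ofrow _ _ rc) (ofrow _ _ re).
  rewrite (ofrow _ _ rd') -coD -coB E -[- (_ + _ + _)]sub0r coB !coD !coZ.
  (* Turns the leftover [co 0] into [0]. *)
  rewrite -(subrr u) coB subrr sub0r -!opprD; congr (- (_ + _ + _)).
  rewrite -{1}(lincomb_delta X i) coK.
  by apply/rowP => j; rewrite !mxE eqxx eq_sym mulr_natr.
by rewrite raddfN /= !mxtraceD mxtrace_scalar !rank1.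
Qed.

Section Evaluation.
Variables (R : realType) (E : normedModType R) (M : manifold E).
Implicit Types (A B C : vfield M) (a : Cinf M) (p : M).

Lemma tangent_eq p (v w : tangent p) : (forall u, v u = w u) -> v = w.
Proof. by move=> vw; apply: val_inj; apply/funext. Qed.

Lemma vfield_eq A B : (forall u p, A u p = B u p) -> A = B.
Proof.
by move=> AB; apply: val_inj; apply/funext => u; apply: Cinf_eq => p; exact: AB.
Qed.

Lemma vfieldDE A B u p : (A + B) u p = A u p + B u p. Proof. by []. Qed.
Lemma vfieldNE A u p : (- A) u p = - A u p. Proof. by []. Qed.
Lemma vfieldZE a A u p : (a *: A) u p = a p * A u p. Proof. by []. Qed.
Lemma bracketE A B u p : bracket A B u p = A (B u) p - B (A u) p.
Proof. by []. Qed.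

Lemma vfieldD A (u w : Cinf M) : A (u + w) = A u + A w.
Proof. by have [l _] := vfieldP A; rewrite -[u]scale1r l !scale1r. Qed.

Lemma vfieldB A (u w : Cinf M) : A (u - w) = A u - A w.
Proof. by have [l _] := vfieldP A; rewrite addrC -scaleN1r l scaleN1r addrC. Qed.

Lemma vfieldM A (u w : Cinf M) : A (u * w) = A u * w + u * A w.
Proof. exact: (vfieldP A).2. Qed.

Lemma vfield_at_linear p a A B :
  vfield_at (a *: A + B) p = a p *: vfield_at A p + vfield_at B p.
Proof. exact: tangent_eq. Qed.

(** Evaluation, named so that its ring morphism structure transports determinants
    and sums. *)
Definition Cinf_at p a : R := a p.

HB.instance Definition _ p := GRing.isZmodMorphism.Build (Cinf M) R (Cinf_at p)
  (fun _ _ => erefl).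
HB.instance Definition _ p := GRing.isMonoidMorphism.Build (Cinf M) R (Cinf_at p)
  (conj erefl (fun _ _ => erefl)).

Lemma CinfB (a b : Cinf M) p : (a - b) p = a p - b p. Proof. by []. Qed.

Lemma Cinf_sum (I : finType) (F : I -> Cinf M) p : (\sum_i F i) p = \sum_i F i p.
Proof. exact: (raddf_sum (Cinf_at p)). Qed.

Definition Cinf_cst (r : R) : Cinf M := mkCinf (@smooth_cst _ _ M r).

(** [K] is a [C^oo]-linear map of vector fields followed by evaluation at [p]; the
    target [V] is [R^o] for functions and the tangent space for fields. *)
Definition linear_at (V : lmodType R) p (K : vfield M -> V) : Prop :=
  forall a A B, K (a *: A + B) = a p *: K A + K B.

Section LinearAt.
Variables (V : lmodType R) (p : M) (K : vfield M -> V).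
Hypothesis lK : linear_at p K.

Lemma linear_atD A B : K (A + B) = K A + K B.
Proof. by rewrite -[A]scale1r lK !scale1r. Qed.

Lemma linear_at0 : K 0 = 0.
Proof. by apply: (addrI (K 0)); rewrite -linear_atD !addr0. Qed.

Lemma linear_atZ a A : K (a *: A) = a p *: K A.
Proof. by rewrite -[a *: A]addr0 lK linear_at0 addr0. Qed.

Lemma linear_at_sum n (a : 'I_n -> Cinf M) (X : 'I_n -> vfield M) :
  K (\sum_i a i *: X i) = \sum_i a i p *: K (X i).
Proof.
rewrite (big_morph K linear_atD linear_at0).
by apply: eq_bigr => i _; rewrite linear_atZ.
Qed.

End LinearAt.

Lemma vfield_at_sum p n (a : 'I_n -> Cinf M) (X : 'I_n -> vfield M) :
  vfield_at (\sum_i a i *: X i) p = \sum_i a i p *: vfield_at (X i) p.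
Proof. exact: (linear_at_sum (@vfield_at_linear p)). Qed.

End Evaluation.

(** * Cramer's rule for fields, and tensoriality *)

Section Framed.
Variables (R : realType) (E : normedModType R) (M : manifold E).
Variables (g : riemannian_metric M) (n : nat).
Hypothesis framed : forall p : M, exists X : 'I_n -> vfield M, basis_at p X.
Implicit Types (A B C : vfield M) (a : Cinf M) (p q : M).

Let gs p := @Defs.metric_sym _ _ _ g p.
Let gl p := @Defs.metric_linear _ _ _ g p.
Let gp p := @Defs.metric_pos _ _ _ g p.

Lemma metricC A B : metric g A B = metric g B A.
Proof. by apply: Cinf_eq => p; exact: gs. Qed.

Lemma metricP a A B C :
  metric g (a *: A + B) C = a * metric g A C + metric g B C.
Proof.
by apply: Cinf_eq => p; rewrite -[LHS]/(g _ _ _) vfield_at_linear gl.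
Qed.

Definition gram_field (X : 'I_n -> vfield M) : 'M[Cinf M]_n :=
  \matrix_(i, j) metric g (X i) (X j).

Definition gram_det X : Cinf M := \det (gram_field X).

(** The extra factor [gram_det X] makes the field vanish wherever [X] degenerates,
    so that its properties hold at every point and not only where [X] is a basis. *)
Definition cramer_field (X : 'I_n -> vfield M) (b : 'rV[Cinf M]_n) : vfield M :=
  \sum_i (gram_det X *: (b *m \adj (gram_field X))) 0 i *: X i.

Lemma gram_field_at X p :
  map_mx (Cinf_at p) (gram_field X) = gram (g p) (fun i => vfield_at (X i) p).
Proof. by apply/matrixP => i j; rewrite !mxE. Qed.

Lemma gram_det_at X p :
  gram_det X p = \det (gram (g p) (fun i => vfield_at (X i) p)).
Proof. by rewrite -gram_field_at det_map_mx. Qed.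

Lemma gram_det_neq0 X p : basis_at p X -> gram_det X p != 0.
Proof.
move=> bX; rewrite gram_det_at -unitfE.
by have := gram_basis_unit (@gs p) (@gl p) (@gp p) bX.
Qed.

(** Needed at points [p] other than the one where [X] was chosen to be a basis; there
    [X] spans because [p] has some basis of the same size. *)
Lemma gram_det_span X p : gram_det X p != 0 ->
  forall v : tangent p, exists c, v = lincomb c (fun i => vfield_at (X i) p).
Proof.
rewrite gram_det_at -unitfE => uX; have [Y bY] := framed p.
exact: (gram_unit_span (@gs p) (@gl p) bY uX).
Qed.

(** When the prescribed functions come from a linear form [om] on the tangent space,
    the Cramer field is metrically dual to [om], up to a square. *)
Lemma cramer_field_at X (b : 'rV[Cinf M]_n) p (om : tangent p -> R^o) : linear om ->
  (forall k, b 0 k p = om (vfield_at (X k) p)) ->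
  forall v, g p (vfield_at (cramer_field X b) p) v = gram_det X p ^+ 2 * om v.
Proof.
move=> lom bE v; set W := cramer_field X b.
(* Both sides carry a factor [gram_det X p]. *)
have [d0|d0] := eqVneq (gram_det X p) 0.
  have -> : vfield_at W p = 0.
    rewrite vfield_at_sum big1// => i _.
    by rewrite mxE CinfM d0 mul0r scale0r.
  rewrite d0 expr0n mul0r.
  exact: (inner0 (@gl p)).
have [c ->] := gram_det_span d0 v.
have -> : om (lincomb c (fun i => vfield_at (X i) p)) =
    \sum_k c 0 k * om (vfield_at (X k) p) by exact: linear_lincomb.
rewrite gs (inner_lincomb (@gl p)) mulr_sumr.
apply: eq_bigr => k _; rewrite -bE mulrCA; congr (_ * _).
rewrite gs -[LHS]/(metric g W (X k) p) expr2 -!CinfM.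
rewrite -[LHS]/(g p (vfield_at W p) (vfield_at (X k) p)) vfield_at_sum.
transitivity (Cinf_at p (((gram_det X *: (b *m \adj (gram_field X))) *m gram_field X) 0 k)).
  rewrite mxE raddf_sum /=.
  rewrite (inner_sum (@gl p)); apply: eq_bigr => i _.
  by rewrite [gram_field _ _ _]mxE.
by rewrite -scalemxAl -mulmxA mul_adj_mx mul_mx_scalar [in LHS]mxE [in LHS]mxE mulrA.
Qed.

Lemma cramer_field_id X A :
  cramer_field X (\row_k metric g A (X k)) = gram_det X ^+ 2 *: A.
Proof.
apply: vfield_eq => u p.
suff : vfield_at (cramer_field X (\row_k metric g A (X k))) p =
       gram_det X p ^+ 2 *: vfield_at A p.
  by move=> /(congr1 (fun v : tangent p => v u)).
apply/eqP; rewrite -subr_eq0; apply/eqP.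
apply: (inner_nondegenerate (@gp p)) => v.
rewrite addrC -scaleNr gl mulNr (cramer_field_at (om := g p (vfield_at A p))) ?addNr//.
  by move=> a v1 v2; rewrite gs gl gs [g p v2 _]gs.
by move=> k; rewrite mxE.
Qed.

(** By [cramer_field_id], [gram_det X ^+ 2 *: A] is a combination of the [X k] with
    coefficients that vanish at [p], and [gram_det X] does not vanish there. *)
Lemma linear_at_tensorial (V : lmodType R) p (K : vfield M -> V) A :
  linear_at p K -> vfield_at A p = 0 -> K A = 0.
Proof.
move=> lK A0; have [X bX] := framed p.
have d0 := gram_det_neq0 bX.
have : gram_det X p ^+ 2 *: K A = 0.
  rewrite expr2 -CinfM -expr2 -(linear_atZ lK) -cramer_field_id.
  rewrite (linear_at_sum lK) big1// => i _.
  rewrite mxE CinfM mxE; move: (gram_det X p) => d.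
  rewrite Cinf_sum big1 ?mulr0 ?scale0r// => k _.
  rewrite CinfM mxE -[metric g A _ _]/(g p _ _) A0.
  by rewrite (inner0 (@gl p)) mul0r.
by move/eqP; rewrite scaler_eq0 expf_eq0 (negbTE d0) => /eqP.
Qed.

Lemma vfield_through p (v : tangent p) : exists A, vfield_at A p = v.
Proof.
have [X bX] := framed p; have [a [-> _]] := bX v.
by exists (\sum_i Cinf_cst M (a 0 i) *: X i); rewrite vfield_at_sum.
Qed.

(** By tensoriality [K] factors through the values of fields at [p], and every tangent
    vector is such a value. *)
Lemma linear_at_ex (V : lmodType R) p (K : vfield M -> V) : linear_at p K ->
  exists2 l : tangent p -> V, linear l & forall A, K A = l (vfield_at A p).
Proof.
move=> lK; have [lft lftE] := choice (@vfield_through p).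
have KE A B : vfield_at A p = vfield_at B p -> K A = K B.
  move=> AB; apply/eqP; rewrite -subr_eq0 -scaleN1r addrC.
  rewrite -(_ : Cinf_cst M (-1) p = -1)// -lK; apply/eqP.
  by apply: linear_at_tensorial => //; rewrite vfield_at_linear AB scaleN1r addNr.
exists (K \o lft) => [a v w|A] /=; last by apply: KE; rewrite lftE.
rewrite -[a *: K _]/(Cinf_cst M a p *: K _) -lK; apply: KE.
by rewrite vfield_at_linear !lftE.
Qed.

End Framed.

(** * Curvature of a semi-symmetric metric connection *)

Section Connections.
Variables (R : realType) (E : normedModType R) (M : manifold E).
Variable (g : riemannian_metric M).
Implicit Types (A B C X : vfield M) (a : Cinf M) (p : M).

Let expandE := (CinfD, CinfN, CinfM, CinfB, vfieldDE, vfieldNE, vfieldZE).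

(** Reduces an identity between fields to an identity in [R].  The functional [K] is
    abstract, so that unification cannot unfold brackets and derivatives under it. *)
Lemma vfield_eq_linear A B :
  (forall p (K : vfield M -> R^o), linear_at p K -> K A = K B) -> A = B.
Proof.
move=> AB; apply: vfield_eq => u p.
exact: (AB p (fun Z => (Z u : Cinf M) p)).
Qed.

Lemma linear_atN p (K : vfield M -> R^o) A : linear_at p K -> K (- A) = - K A.
Proof.
by move=> lK; rewrite -scaleN1r (linear_atZ lK) -[LHS]/(-1 * K A) mulN1r.
Qed.

Lemma linear_atM p (K : vfield M -> R^o) a A :
  linear_at p K -> K (a *: A) = a p * K A.
Proof. by move=> lK; rewrite (linear_atZ lK). Qed.

Let linE p (K : vfield M -> R^o) (lK : linear_at p K) :=
  (linear_atD lK, fun A => linear_atN A lK, fun a A => linear_atM a A lK).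

Lemma metricDl A B C : metric g (A + B) C = metric g A C + metric g B C.
Proof. by rewrite -[A]scale1r metricP mul1r scale1r. Qed.

Lemma metricDr A B C : metric g C (A + B) = metric g C A + metric g C B.
Proof. by rewrite metricC metricDl ![metric g C _]metricC. Qed.

Lemma metricZl a A C : metric g (a *: A) C = a * metric g A C.
Proof.
have m0 : metric g 0 C = 0.
  by apply: (addrI (metric g 0 C)); rewrite -metricDl !addr0.
by rewrite -[a *: A]addr0 metricP m0 addr0.
Qed.

Lemma metricZr a A C : metric g C (a *: A) = a * metric g C A.
Proof. by rewrite metricC metricZl metricC. Qed.

Lemma metricNl A C : metric g (- A) C = - metric g A C.
Proof. by rewrite -scaleN1r metricZl mulN1r. Qed.

Lemma metricNr A C : metric g C (- A) = - metric g C A.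
Proof. by rewrite metricC metricNl metricC. Qed.

Lemma bracket_linear a A B C :
  bracket (a *: A + B) C = a *: bracket A C + bracket B C - (C a : Cinf M) *: A.
Proof.
apply: vfield_eq => u p.
rewrite !(bracketE, expandE).
have -> : (a *: A + B) u = a * (A u : Cinf M) + B u by apply: Cinf_eq.
by rewrite vfieldD vfieldM !expandE; ring.
Qed.

Lemma bracketC A B : bracket A B = - bracket B A.
Proof. by apply: vfield_eq => u p; rewrite vfieldNE !bracketE opprB. Qed.

Lemma jacobi A B C :
  bracket A (bracket B C) + bracket B (bracket C A) + bracket C (bracket A B) = 0.
Proof.
apply: vfield_eq => u p; rewrite !vfieldDE !bracketE.
have brE A' B' : bracket A' B' u = A' (B' u) - B' (A' u) :> Cinf M by [].
rewrite !brE !vfieldB !expandE -[RHS]/0; ring.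
Qed.

(** The exterior derivative of the one-form metrically dual to [P]. *)
Definition dual_form_d (P A C : vfield M) : Cinf M :=
  A (metric g C P) - C (metric g A P) - metric g (bracket A C) P.

Lemma dual_form_dC P A C : dual_form_d P A C = - dual_form_d P C A.
Proof.
rewrite /dual_form_d bracketC metricNl; apply: Cinf_eq => p; rewrite !expandE.
ring.
Qed.

Lemma dual_form_d_linear P C p : linear_at p (fun A => dual_form_d P A C p : R^o).
Proof.
move=> a A B; rewrite /dual_form_d bracket_linear !(metricDl, metricNl, metricZl).
rewrite vfieldD vfieldM -[RHS]/(a p * dual_form_d P A C p + dual_form_d P B C p).
rewrite /dual_form_d !expandE; ring.
Qed.

Section Connection.
Variable D : vfield M -> vfield M -> vfield M.
Hypothesis conD : is_connection D.

Lemma connection_linear a A B C : D (a *: A + B) C = a *: D A C + D B C.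
Proof. by case: conD. Qed.

Lemma connectionDl A B C : D (A + B) C = D A C + D B C.
Proof. by rewrite -[A]scale1r connection_linear !scale1r. Qed.

Lemma connection0l C : D 0 C = 0.
Proof. by apply: (addrI (D 0 C)); rewrite -connectionDl !addr0. Qed.

Lemma connectionZl a A C : D (a *: A) C = a *: D A C.
Proof. by rewrite -[a *: A]addr0 connection_linear connection0l addr0. Qed.

Lemma connectionNl A C : D (- A) C = - D A C.
Proof. by rewrite -scaleN1r connectionZl scaleN1r. Qed.

Lemma connectionDr A B C : D C (A + B) = D C A + D C B.
Proof. by case: conD. Qed.

Lemma connection_leibniz a A C : D C (a *: A) = (C a : Cinf M) *: A + a *: D C A.
Proof. by case: conD. Qed.

Lemma connectionNr A C : D C (- A) = - D C A.
Proof.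
have D0 : D C 0 = 0 by apply: (addrI (D C 0)); rewrite -connectionDr !addr0.
by apply/eqP; rewrite -addr_eq0 -connectionDr addNr D0.
Qed.

Definition conE := (connectionDl, connectionZl, connectionNl, connectionDr,
  connectionNr, connection_leibniz).

Lemma curvatureC A C X : curvature D A C X = - curvature D C A X.
Proof.
rewrite /curvature (bracketC A C) connectionNl.
by apply: vfield_eq_linear => p K /linE lin; rewrite !lin; ring.
Qed.

Lemma curvature_linear1 p C X :
  linear_at p (fun A => vfield_at (curvature D A C X) p).
Proof.
move=> a A B; rewrite -vfield_at_linear.
suff -> : curvature D (a *: A + B) C X =
  a *: curvature D A C X + curvature D B C X by [].
rewrite /curvature bracket_linear !conE.
by apply: vfield_eq_linear => q K /linE lin; rewrite !lin ?expandE; ring.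
Qed.

Lemma curvature_linear3 p A C :
  linear_at p (fun X => vfield_at (curvature D A C X) p).
Proof.
move=> a X Y; rewrite -vfield_at_linear.
suff -> : curvature D A C (a *: X + Y) =
  a *: curvature D A C X + curvature D A C Y by [].
rewrite /curvature !conE.
by apply: vfield_eq_linear => q K /linE lin; rewrite !lin ?expandE; ring.
Qed.

(** Compare both sides of [[A, C] u = A (C u) - C (A u)] for [u = g(X, X)]. *)
Lemma curvature_skew A C X : metric_compatible g D ->
  metric g (curvature D A C X) X = 0.
Proof.
move=> mD.
have mD2 B : B (metric g X X) = metric g (D B X) X *+ 2.
  by rewrite mD metricC mulr2n.
have br : bracket A C (metric g X X) =
   A (C (metric g X X)) - C (A (metric g X X)) :> Cinf M by [].
move: br; rewrite !mD2 !mulr2n !vfieldD !mD => br.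
rewrite /curvature !(metricDl, metricNl); apply: Cinf_eq => p.
move/(congr1 (fun v : Cinf M => v p)): br.
rewrite (metricC g (D A X) (D C X)) !expandE => br.
rewrite -[RHS]/0.
move: br; do 4![move: (metric g _ _ p) => ?]; lra.
Qed.

(** The torsion lets [D B (D C' X')] trade its two inner arguments at the price of a
    double bracket and of terms in [P]; in the cyclic sum the double brackets cancel
    by Jacobi and the terms in [P] assemble into exterior derivatives. *)
Lemma bianchi_semi_symmetric P :
  (forall A C, D A C - D C A =
     bracket A C + (metric g C P *: A - metric g A P *: C)) ->
  forall A C X,
    curvature D A C X + curvature D C X A + curvature D X A C =
    - (dual_form_d P C X *: A + dual_form_d P X A *: C + dual_form_d P A C *: X).
Proof.
move=> torD A C X; rewrite /curvature.
have torDE B C' : D B C' =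
    D C' B + bracket B C' + metric g C' P *: B - metric g B P *: C'.
  by rewrite -!addrA -torD addrC subrK.
(* The torsion identity twice: under [D B], and for the pair [B], [bracket C' X']. *)
have step B C' X' : D B (D C' X') = D B (D X' C') + D (bracket C' X') B
   + bracket B (bracket C' X')
   + metric g (bracket C' X') P *: B - metric g B P *: bracket C' X'
   + (B (metric g X' P) : Cinf M) *: C' + metric g X' P *: D B C'
   - (B (metric g C' P) : Cinf M) *: X' - metric g C' P *: D B X'.
  rewrite (torDE C' X') !conE (torDE B (bracket C' X')).
  by apply: vfield_eq_linear => p K /linE lin; rewrite !lin; ring.
rewrite (step A C X) (step C X A) (step X A C) (torDE A C) (torDE C X) (torDE X A).
have jac := jacobi A C X.
apply: vfield_eq_linear => p K lK.
have K0 := linear_at0 lK.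
move/(congr1 K): jac; rewrite K0.
rewrite /dual_form_d (bracketC X A) !(conE, metricNl) !(linE lK) !(CinfD, CinfN).
by move=> jac; apply/eqP; rewrite -subr_eq0 -[X in _ == X]jac; apply/eqP; ring.
Qed.

End Connection.

Lemma semi_symmetric_connection D P : is_connection D ->
  is_connection (semi_symmetric_metric_connection g D P).
Proof.
move=> cD; rewrite /semi_symmetric_metric_connection.
split=> [a A B C|A B C|A a C]; rewrite !(conE cD) ?(metricDl, metricDr, metricZl, metricZr).
all: by apply: vfield_eq_linear => p K /linE lin; rewrite !lin ?expandE; ring.
Qed.

Lemma semi_symmetric_metric D P : metric_compatible g D ->
  metric_compatible g (semi_symmetric_metric_connection g D P).
Proof.
move=> mD A B C; rewrite mD /semi_symmetric_metric_connection.
rewrite !(metricDl, metricDr, metricNl, metricNr, metricZl, metricZr).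
rewrite (metricC g A B) (metricC g P C).
by apply: Cinf_eq => p; rewrite !expandE; ring.
Qed.

Lemma semi_symmetric_torsion D P : torsion_free D -> forall A C,
  semi_symmetric_metric_connection g D P A C -
  semi_symmetric_metric_connection g D P C A =
  bracket A C + (metric g C P *: A - metric g A P *: C).
Proof.
move=> tD A C; rewrite -tD /semi_symmetric_metric_connection (metricC g C A).
by apply: vfield_eq_linear => p K /linE lin; rewrite !lin; ring.
Qed.

End Connections.

(** * The Ricci tensor and closedness of the dual form *)

Section Ricci.
Variables (R : realType) (E : normedModType R) (M : manifold E).
Variables (g : riemannian_metric M) (n : nat).
Variables (nabla : vfield M -> vfield M -> vfield M) (P : vfield M).
Hypothesis nabla_LC : levi_civita g nabla.

Let D := semi_symmetric_metric_connection g nabla P.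

(** The traces that define the Ricci tensor come with bases, at every point. *)
Lemma is_ricci_framed S :
  is_ricci n D S -> forall p, exists X : 'I_n -> vfield M, basis_at p X.
Proof. by move=> ric p; have [X [c [bX _ _]]] := ric 0 0 p; exists X. Qed.

(** The trace of [bianchi_semi_symmetric] over [A].  The term with [dpi(C, X)] is a
    multiple of the identity and contributes [n] times; each of the two others has
    rank one and contributes [- dpi(C, X)]. *)
Lemma ricci_antisym S : is_ricci n D S -> forall C X,
  S C X - S X C = dual_form_d g P C X *+ 2 - dual_form_d g P C X *+ n.
Proof.
case: nabla_LC => cN tN mN ric C X; apply: Cinf_eq => p.
have framed := is_ricci_framed ric.
have cD : is_connection D := semi_symmetric_connection g P cN.
have mD : metric_compatible g D := semi_symmetric_metric P mN.
have tD := semi_symmetric_torsion g P tN.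
have [Y [c [bY rc Sc]]] := ric C X p; have [Z [d [bZ rd Sd]]] := ric X C p.
have [l ll lE] := linear_at_ex g framed (curvature_linear1 cD p C X).
have [m lm mE] := linear_at_ex g framed (curvature_linear1 cD p X C).
have [s ls sE] := linear_at_ex g framed (curvature_linear3 cD p C X).
have [phi lphi phiE] := linear_at_ex g framed (dual_form_d_linear g P X p).
have [psi lpsi psiE] := linear_at_ex g framed (dual_form_d_linear g P C p).
rewrite CinfB Sc Sd.
have skew v : g p (s v) v = 0.
  have [A <-] := vfield_through framed v.
  rewrite -sE -[LHS]/(metric g (curvature D C X A) A p).
  by rewrite (curvature_skew _ _ _ mD).
have cyclic v : l v + s v - m v = - (dual_form_d g P C X p *: v
    + (- phi v) *: vfield_at C p + psi v *: vfield_at X p).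
  have [A <-] := vfield_through framed v.
  have := congr1 (fun B => vfield_at B p) (@bianchi_semi_symmetric _ _ _ g D cD P tD A C X).
  rewrite (curvatureC cD X A) (dual_form_dC g P X A) -psiE -phiE -lE -mE -sE.
  move=> E1; apply: etrans (etrans E1 _); exact: tangent_eq.
have lphi' : linear (fun v => - phi v : R^o).
  by move=> a v w; rewrite lphi opprD scalerN.
have rc' : represents (fun i => vfield_at (Y i) p) c l by move=> i; rewrite -lE rc.
have rd' : represents (fun i => vfield_at (Z i) p) d m by move=> i; rewrite -mE rd.
rewrite (trace_bianchi (@Defs.metric_sym _ _ _ g p) (@metric_linear _ _ _ g p)
  (@metric_pos _ _ _ g p) bY bZ ll lm ls lphi' lpsi rc' rd' skew cyclic).
rewrite -phiE -psiE (dual_form_dC g P X C); move: (dual_form_d g P C X) => w.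
have wn k : (w *+ k) p = w p *+ k by exact: (raddfMn (Cinf_at p)).
by rewrite CinfB !wn CinfN mulr2n; move: (w p *+ n) (w p) => x y; ring.
Qed.

Lemma einstein_dual_form_d : (2 < n)%N -> einstein n g D ->
  forall C X, dual_form_d g P C X = 0.
Proof.
move=> n_gt2 [S [al [ric SE]]] C X; have := ricci_antisym ric C X.
rewrite !SE (metricC g X) subrr; move: (dual_form_d g P C X) => w E0.
apply: Cinf_eq => p; have : w p *+ 2 - w p *+ n = 0.
  rewrite -![w p *+ _](raddfMn (Cinf_at p)) -(raddfB (Cinf_at p)) -E0.
  exact: (raddf0 (Cinf_at p)).
move/eqP; rewrite -(subnKC (ltnW n_gt2)) mulrnDr opprD addrA subrr sub0r.
by rewrite oppr_eq0 mulrn_eq0 subn_eq0 leqNgt n_gt2 => /eqP.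
Qed.

End Ricci.

(** * Slices of a product *)

Section Slices.
Variable R : realType.

(** Affine maps have a constant differential [L], so directional derivatives of the
    composite are again composites of this kind. *)
Lemma smooth_on_affine (E E' G : normedModType R) (i : E -> E') (L : E -> E')
    (U : set E') (f : E' -> G) :
  (forall x, is_diff x i L) -> open U ->
  smooth_on U f -> smooth_on (i @^-1` U) (f \o i).
Proof.
move=> iL oU + k => /(_ k).
have di x : differentiable i x by have := iL x => ?; exact: ex_diff.
have ci : continuous i by move=> x; exact: differentiable_continuous.
have oV : open (i @^-1` U) by apply: open_comp => // x _; exact: ci.
elim: k f => [|k IH] f; first by move=> cf x Ux; apply: continuous_comp; [exact: ci|exact: cf].
move=> [df Df]; split=> [x Ux|v].
  by apply: differentiable_comp; [exact: di|exact: df].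
apply: (Ck_on_eq oV _ (IH _ (Df (L v)))) => x Ux /=.
rewrite !deriveE; last 2 first.
- by apply: differentiable_comp; [exact: di|exact: df].
- exact: df.
have iLx := iL x; have iE : 'd i x v = L v by rewrite diff_val.
by rewrite (diff_comp (di x) (df _ Ux)) /= iE.
Qed.

Variables (E1 E2 : normedModType R) (M : manifold E1) (N : manifold E2).

Lemma prod_chart_open (c : chart E1 M) (d : chart E2 N) :
  @atlas _ _ M c -> @atlas _ _ N d ->
  open (prod_chart c d @` (chart_dom (prod_chart c d) `&` setT)).
Proof.
move=> ac ad; have [oc _ _ Oc] := prod_chart_chart (atlas_chart ac) (atlas_chart ad).
by rewrite setIT; exact: Oc.
Qed.

Lemma slice1_smooth (y : N) (u : Cinf (prod_manifold M N)) :
  @smooth _ _ M (u \o (fun x => (x, y))).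
Proof.
move=> c ac; have [d ad dy] := atlas_cover y.
have acd : @atlas _ _ (prod_manifold M N) (prod_chart c d) by exists (c, d).
have [phi sphi uphi] := Cinf_smooth u acd.
exists (phi \o (fun x => (x, d y))); last by move=> x cx _; exact: uphi.
move=> k; apply: Ck_on_sub (smooth_on_affine (L := fun v => (v, 0)) _ (prod_chart_open ac ad) sphi k).
  by move=> _ [x [cx _] <-]; exists (x, y).
Qed.

Lemma slice2_smooth (x : M) (u : Cinf (prod_manifold M N)) :
  @smooth _ _ N (u \o (fun y => (x, y))).
Proof.
move=> d ad; have [c ac cx] := atlas_cover x.
have acd : @atlas _ _ (prod_manifold M N) (prod_chart c d) by exists (c, d).
have [phi sphi uphi] := Cinf_smooth u acd.
exists (phi \o (fun y => (c x, y))); last by move=> y dy _; exact: uphi.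
move=> k; apply: Ck_on_sub (smooth_on_affine (L := fun v => (0, v)) _ (prod_chart_open ac ad) sphi k).
  by move=> _ [y [dy _] <-]; exists (x, y).
Qed.

Definition slice1 (y : N) : smooth_map M (prod_manifold M N) :=
  SmoothMap (slice1_smooth y).

Definition slice2 (x : M) : smooth_map N (prod_manifold M N) :=
  SmoothMap (slice2_smooth x).

End Slices.

(** * Functions without differential *)

Section CriticalPoints.
Variables (R : realType) (E : normedModType R) (M : manifold E).

Lemma tangent_cst (p : M) (v : tangent p) (r : R) : v (Cinf_cst M r) = 0.
Proof.
have [vl vd] := tangentP v.
have v1 : v 1 = 0.
  have := vd 1 1; rewrite mul1r -[(1 : Cinf M) p]/(1 : R) mulr1 mul1r => /eqP.
  by rewrite addrC -subr_eq subrr eq_sym => /eqP.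
have v0 : v 0 = 0.
  have := vl (-1) 0 0; rewrite scaler0 addr0 mulN1r addNr; exact.
have -> : Cinf_cst M r = r *: (1 : Cinf M) + 0.
  by apply: Cinf_eq => q; rewrite CinfD CinfZ -[(1 : Cinf M) q]/(1 : R)
    mulr1 -[(0 : Cinf M) q]/(0 : R) addr0.
by rewrite vl v1 v0 mulr0 addr0.
Qed.

(** The velocity at [p] of the curve that is a line of direction [e] in the chart.
    Reading functions in the chart turns it into a derivation of global functions,
    without any extension of local functions. *)
Lemma chart_tangent (c : chart E M) (p : M) (e : E) :
  @atlas _ _ M c -> chart_dom c p -> exists v : tangent p,
  forall (u : Cinf M) (phi : E -> R^o), smooth_on (c @` chart_dom c) phi ->
    (forall q, chart_dom c q -> u q = phi (c q)) -> v u = 'D_e phi (c p).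
Proof.
move=> ac cp; have [oc _ _ Oc] := atlas_chart ac.
have nc : nbhs (c p) (c @` chart_dom c).
  by apply: open_nbhs_nbhs; split; [exact: Oc|exists p].
have loc (u : Cinf M) : exists phi : E -> R^o, smooth_on (c @` chart_dom c) phi /\
    forall q, chart_dom c q -> u q = phi (c q).
  have [phi sphi uphi] := Cinf_smooth u ac; exists phi; split=> [|q cq].
    by move: sphi; rewrite setIT.
  exact: uphi.
have [rep repP] := choice loc.
have uniq (u : Cinf M) (phi psi : E -> R^o) :
    (forall q, chart_dom c q -> u q = phi (c q)) ->
    (forall q, chart_dom c q -> u q = psi (c q)) ->
    'D_e phi (c p) = 'D_e psi (c p).
  move=> uphi upsi; apply: near_eq_derive.
  by apply: filterS nc => _ [q cq <-]; rewrite -uphi// -upsi.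
have drv u : derivable (rep u) (c p) e.
  by apply: diff_derivable; have [/(_ 1%N)[+ _] _] := repP u; apply; exists p.
have pd : point_derivation p (fun u => 'D_e (rep u) (c p)).
  split=> [a u w|u w].
    rewrite (uniq _ _ (a *: rep u + rep w) (repP _).2); last first.
      by move=> q cq; rewrite CinfD CinfZ (repP u).2// (repP w).2.
    by rewrite deriveD ?deriveZ//; exact: derivableZ.
  rewrite (uniq _ _ (rep u * rep w) (repP _).2); last first.
    by move=> q cq; rewrite CinfM (repP u).2// (repP w).2.
  rewrite deriveM// (repP u).2// (repP w).2// addrC; congr (_ + _).
  exact: mulrC.
exists (MkTangent (introT (tangent_predP _ _) pd)) => u phi _ uphi.
exact: uniq (repP u).2 uphi.
Qed.

(** The mean value theorem on the segment from [x] to [y]. *)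
Lemma derive0_ball (phi : E -> R^o) (x : E) (r : R) :
  (forall y, ball x r y -> differentiable phi y) ->
  (forall y e, ball x r y -> 'D_e phi y = 0) ->
  forall y, ball x r y -> phi y = phi x.
Proof.
move=> dphi phi0 y xy.
pose l (s : R) := x + s *: (y - x).
have lb s : 0 <= s <= 1 -> ball x r (l s).
  move=> /andP[s0 s1]; move: xy; rewrite -!ball_normE /= /l opprD addNKr normrN.
  rewrite normrZ ger0_norm// distrC; apply: le_lt_trans.
  by rewrite -[leRHS]mul1r ler_wpM2r.
have dl s : is_diff (s : R^o) (l : R^o -> E) (fun t => t *: (y - x)).
  rewrite (_ : l = cst x + *:%R^~ (y - x)); last exact/funext.
  by apply: is_diff_eq; rewrite add0r.
have Dl s : 0 <= s <= 1 -> is_derive (s : R^o) (1 : R^o) (phi \o l : R^o -> R^o) 0.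
  move=> s01; have dphil : differentiable (phi \o l : R^o -> R^o) s.
    by apply: differentiable_comp => //; exact/dphi/lb.
  apply: DeriveDef; first exact: diff_derivable.
  rewrite deriveE// diff_comp//; last exact/dphi/lb.
  by rewrite /= -deriveE ?phi0//; [exact/lb|exact/dphi/lb].
have [||s _] := @MVT R (phi \o l) (fun=> 0) 0 1 ltr01.
- by move=> s; rewrite in_itv /= => /andP[s0 s1]; apply: Dl; rewrite !ltW.
- apply: derivable_within_continuous => s; rewrite in_itv /= => s01.
  by have [] := Dl s s01.
by rewrite mul0r /= /l scale1r scale0r addr0 subrKC => /eqP; rewrite subr_eq0 => /eqP.
Qed.

(** Charts supply enough tangent vectors to make all directional derivatives of [u]
    vanish, so [u] is locally constant and its level sets are open and closed. *)
Lemma critical_constant (u : Cinf M) : connected [set: M] ->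
  (forall p (v : tangent p), v u = 0) -> exists r : R, forall p, u p = r.
Proof.
move=> cM u0.
have loc p : \forall q \near p, u q = u p.
  have [c ac cp] := atlas_cover p; have [oc _ cc Oc] := atlas_chart ac.
  have [phi] := Cinf_smooth u ac; rewrite setIT => sphi uphi.
  have nc : nbhs (c p) (c @` chart_dom c).
    by apply: open_nbhs_nbhs; split; [exact: Oc|exists p].
  have [r /= r0 rc] := (nbhs_ballP _ _).1 nc.
  have : \forall q \near p, ball (c p) r (c q) by apply: cc => //; exact: nbhsx_ballx.
  have : \forall q \near p, chart_dom c q by exact: open_nbhs_nbhs.
  apply: filterS2 => q cq qr; rewrite !uphi//.
  apply: (derive0_ball _ _ qr) => [y /rc cy|y e /rc[q' cq' <-]].
    by have [+ _] := sphi 1%N; apply.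
  have [v vE] := chart_tangent e ac cq'.
  by rewrite -(vE u)// => q'' cq''; exact: uphi.
have [[p0 _]|M0] := pselect ([set: M] !=set0); last first.
  by exists 0 => p; exfalso; apply: M0; exists p.
exists (u p0) => p; set B := [set q | u q = u p0].
suff B_T : B = setT by have : B p by rewrite B_T.
have oB : open B.
  rewrite openE => q Bq; rewrite /interior; near=> q'.
  by rewrite /B /= (near (loc q) q')// -[u q]/(u q) Bq.
have oBc : open (~` B).
  rewrite openE => q Bq; rewrite /interior; near=> q'.
  by rewrite /B /= (near (loc q) q').
apply: cM; first by exists p0.
  by exists B => //; rewrite setTI.
by exists B; [rewrite -[B]setCK; exact: open_closedC|rewrite setTI].
Unshelve. all: by end_near. Qed.

End CriticalPoints.

(** * Doubly warped products *)

Section Warped.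
Variables (R : realType) (E1 E2 : normedModType R).
Variables (B : manifold E1) (F : manifold E2).
Let M := prod_manifold B F.
Variables (gB : riemannian_metric B) (gF : riemannian_metric F).
Variables (f : Cinf F) (h : Cinf B) (g : riemannian_metric M).
Hypothesis warped : is_doubly_warped gB gF f h g.
Variables (Q : vfield B) (P : vfield M).
Hypothesis lift : is_lift1 Q P.

Let rho := proj1 B F.
Let sigma := proj2 B F.

Lemma warped_horizontal (p : M) (v w : tangent p) : differential sigma w = 0 ->
  g p v w = f p.2 ^+ 2 * gB _ (differential rho v) (differential rho w).
Proof.
have [_ _ gE] := warped; move=> w0; rewrite gE w0 [gF _ _ _]Defs.metric_sym.
by rewrite (inner0 (@metric_linear _ _ _ gF _)) mulr0 addr0.
Qed.

Lemma warped_orthogonal (p : M) (v w : tangent p) : differential rho v = 0 ->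
  differential sigma w = 0 -> g p v w = 0.
Proof.
move=> v0 /warped_horizontal ->.
by rewrite v0 (inner0 (@metric_linear _ _ _ gB _)) mulr0.
Qed.

Lemma lift_proj2 p : differential sigma (vfield_at P p) = 0.
Proof.
apply: tangent_eq => u; have [_ lF] := lift.
by rewrite -[LHS]/(P (pullback sigma u) p) lF.
Qed.

Lemma lift_proj1 (p : M) :
  differential rho (vfield_at P p) = vfield_at Q (rho p).
Proof.
apply: tangent_eq => u; have [lB _] := lift.
by rewrite -[LHS]/(P (pullback rho u) p) lB.
Qed.

Lemma lift_norm :
  metric g P P = pullback sigma (f ^+ 2) * pullback rho (metric gB Q Q).
Proof.
apply: Cinf_eq => p; rewrite -[LHS]/(g p _ _).
by rewrite (warped_horizontal _ (lift_proj2 p)) lift_proj1.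
Qed.

Lemma differential_proj1_slice1 (y : F) (t : B) (w : tangent t) :
  differential rho (differential (slice1 B y) w) = w.
Proof. by apply: tangent_eq => u; congr (w _); exact: Cinf_eq. Qed.

Lemma differential_proj2_slice1 (y : F) (t : B) (w : tangent t) :
  differential sigma (differential (slice1 B y) w) = 0.
Proof.
apply: tangent_eq => u; rewrite -[RHS](tangent_cst w (u y)).
by congr (w _); exact: Cinf_eq.
Qed.

(** Test [v] against the horizontal lift of its own projection, which the slice
    through the point provides. *)
Lemma vertical_of_orthogonal (p : M) (v : tangent p) :
  (forall w : tangent p, differential sigma w = 0 -> g p v w = 0) ->
  differential rho v = 0.
Proof.
case: p v => t y v v0; apply/eqP; apply: contraT => w0.
have [f0 _ _] := warped; have := v0 _ (differential_proj2_slice1 y (differential rho v)).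
rewrite (warped_horizontal _ (differential_proj2_slice1 y _)) differential_proj1_slice1 => /eqP.
rewrite mulf_eq0 expf_eq0 /= (gt_eqF (f0 y)) /=.
by rewrite (gt_eqF (metric_pos gB w0)).
Qed.

(** Of the three terms of [dpi(V, P)] only [V (g(P, P))] survives: [V] is orthogonal
    to [P], and [[V, P]] is again vertical since [P] maps functions of [B] to
    functions of [B]. *)
Lemma lift_metric_dual_form_d (V : vfield M) : (forall u, V (pullback rho u) = 0) ->
  dual_form_d g P V P =
  V (pullback sigma f) * pullback sigma f * pullback rho (metric gB Q Q) *+ 2.
Proof.
move=> V0; rewrite /dual_form_d.
have rhoV p : differential rho (vfield_at V p) = 0.
  by apply: tangent_eq => u; rewrite -[LHS]/(V (pullback rho u) p) V0.
have -> : metric g V P = 0.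
  by apply: Cinf_eq => p; exact: warped_orthogonal (rhoV p) (lift_proj2 p).
have -> : metric g (bracket V P) P = 0.
  apply: Cinf_eq => p; apply: warped_orthogonal (lift_proj2 p).
  apply: tangent_eq => u; have [lB _] := lift.
  rewrite -[LHS]/((V (P (pullback rho u)) - P (V (pullback rho u)) : Cinf M) p).
  rewrite V0 lB V0; have -> : P 0 = 0 by apply: (addrI (P 0)); rewrite -vfieldD !addr0.
  by rewrite subrr.
have -> : P 0 = 0 by apply: (addrI (P 0)); rewrite -vfieldD !addr0.
rewrite !subr0 lift_norm vfieldM V0 mulr0 addr0.
have -> : pullback sigma (f ^+ 2) = pullback sigma f * pullback sigma f.
  by apply: Cinf_eq.
by rewrite vfieldM mulr2n -mulrDl [_ * V _]mulrC.
Qed.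

Variable n : nat.
Hypothesis framed : forall p : M, exists X : 'I_n -> vfield M, basis_at p X.
Hypothesis closed_P : forall A C, dual_form_d g P A C = 0.

(** [V] below is a multiple of the gradient of [f] on the product.  It is vertical,
    because [f] does not vary along [B], so that closedness applies to it; at [(t, y)]
    this yields [V f = 0], and then [V = 0] since [V f] is proportional to
    [g(V, V)]. *)
Lemma closed_lift_critical (t : B) : vfield_at Q t != 0 ->
  forall (y : F) (w : tangent y), w f = 0.
Proof.
move=> Qt y w; have [f0 _ _] := warped.
pose p : M := (t, y); have [X bX] := framed p.
pose V := cramer_field g X (\row_k (X k (pullback sigma f) : Cinf M)).
have gV q (v : tangent q) :
    g q (vfield_at V q) v = gram_det g X q ^+ 2 * v (pullback sigma f).
  apply: (@cramer_field_at _ _ _ g n framed X _ q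
    (fun v : tangent q => v (pullback sigma f))) => //.
  by move=> k; rewrite mxE.
have rhoV q : differential rho (vfield_at V q) = 0.
  apply: vertical_of_orthogonal => v sv; rewrite gV.
  by rewrite -[v _]/(differential sigma v f) sv mulr0.
have V0 u : V (pullback rho u) = 0.
  by apply: Cinf_eq => q; rewrite -[LHS]/(differential rho (vfield_at V q) u) rhoV.
have d0 := gram_det_neq0 g bX.
have Vf : V (pullback sigma f) p = 0.
  have E := congr1 (fun u : Cinf M => u p) (closed_P V P).
  rewrite (lift_metric_dual_form_d V0) in E.
  have /eqP : (V (pullback sigma f) : Cinf M) p * f y *
    gB t (vfield_at Q t) (vfield_at Q t) *+ 2 = 0 by exact: E.
  by rewrite mulrn_eq0 /= !mulf_eq0 (gt_eqF (f0 y)) (gt_eqF (metric_pos gB Qt))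
    !orbF => /eqP.
have Vp : vfield_at V p = 0.
  apply/eqP; apply: contraT => /(metric_pos g).
  by rewrite gV -[vfield_at V p _]/(V (pullback sigma f) p) Vf mulr0 ltxx.
have := gV p (differential (slice2 F t) w).
rewrite Vp (inner0 (@metric_linear _ _ _ g _)) => /esym/eqP.
rewrite mulf_eq0 expf_eq0 (negbTE d0) /= => /eqP <-.
by congr (w _); exact: Cinf_eq.
Qed.

Lemma lift_eq0 : (forall t, vfield_at Q t = 0) -> P = 0.
Proof.
move=> Q0; apply: vfield_eq => u p.
suff P0 : vfield_at P p = 0 by exact: (congr1 (fun v : tangent p => v u) P0).
apply: (inner_nondegenerate (@metric_pos _ _ _ g p)) => w.
rewrite Defs.metric_sym (warped_horizontal _ (lift_proj2 p)) lift_proj1 Q0.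
by rewrite Defs.metric_sym (inner0 (@metric_linear _ _ _ gB _)) mulr0.
Qed.

End Warped.

Theorem theorem5p3 (R : realType)
    (I : set R) (I_open : open I) (I_itv : is_interval I) (I_nonempty : I !=set0)
    (n : nat) (n_ge3 : (3 <= n)%N)
    (F : manifold 'rV[R]_n.-1) (F_connected : connected [set: F])
    (gI : riemannian_metric (real_open_manifold I_open))
    (gF : riemannian_metric F)
    (f : Cinf F) (h : Cinf (real_open_manifold I_open))
    (g : riemannian_metric (prod_manifold (real_open_manifold I_open) F))
    (g_warped : is_doubly_warped gI gF f h g)
    (nabla : vfield (prod_manifold (real_open_manifold I_open) F) ->
             vfield (prod_manifold (real_open_manifold I_open) F) ->
             vfield (prod_manifold (real_open_manifold I_open) F))
    (nabla_LC : levi_civita g nabla)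
    (Q : vfield (real_open_manifold I_open))
    (P : vfield (prod_manifold (real_open_manifold I_open) F))
    (P_lift : is_lift1 Q P)
    (M_einstein : einstein n g (semi_symmetric_metric_connection g nabla P)) :
  (exists c : R, forall x : F, f x = c) \/
  P (pullback (proj1 (real_open_manifold I_open) F) h) =
    pullback (proj1 (real_open_manifold I_open) F) h * metric g P P.
Proof.
have [S [al [ric _]]] := M_einstein.
have framed := is_ricci_framed ric.
have closed_P := einstein_dual_form_d nabla_LC n_ge3 M_einstein.
have [[t Qt]|Q0] := pselect (exists t, vfield_at Q t != 0).
  left; apply: critical_constant => // y w.
  exact: (closed_lift_critical g_warped P_lift framed closed_P Qt w).
right; have -> : P = 0.
  apply: (lift_eq0 g_warped P_lift) => t.
  by apply/eqP; apply: contraT => Qt; exfalso; apply: Q0; exists t.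
have -> : metric g 0 0 = 0.
  by rewrite -[X in metric g X _](scale0r 0) metricZl mul0r.
by rewrite mulr0; apply: Cinf_eq.
Qed.
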